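(* Let $d\ge 1$ and let $\eta$ be an $\mathbb{N}$-valued random variable with $\mathbf{P}[\eta\ge1]>0$. Suppose that $\mathbf{E}\big[(\log(\eta\vee 1))^d\big]<\infty$. Then $p_u(\mathbb{Z}^d,\eta)=1$.
   Context: Here $a\vee b=\max\{a,b\}$, $\mathbb{N}=\{0,1,2,\dots\}$, and $\mathbb{Z}^d$ denotes the graph with vertex set $\mathbb{Z}^d$ and edges between points at $\ell^1$-distance $1$, with root $\mathbf{0}$ the origin. Frog model $\mathrm{FM}(\mathcal{G},p,\eta)$. Let $\mathcal{G}$ be an infinite connected undirected graph all of whose sites (vertices) have finite degree, with a fixed site $\mathbf{0}$ called the root; let $p\in[0,1]$ and let $\eta$ be a random variable with values in $\mathbb{N}$. Let $\{\eta(x)\}_{x}$, $\{(S^x_n(i))_{n\in\mathbb{N}}\}_{x,\,i\ge1}$, $\{\Xi^x_p(i)\}_{x,\,i\ge 1}$ be independent families of independent random variables, where $\eta(x)$ has the law of $\eta$, $(S^x_n(i))_n$ is a discrete-time simple random walk on $\mathcal{G}$ started from $x$, and $\mathbf{P}[\Xi^x_p(i)=k]=(1-p)p^{k-1}$, $k=1,2,\dots$ (for $p=1$, $\Xi^x_p(i)=\infty$, no death). Site $x$ initially contains $\eta(x)$ particles; at time $0$ all particles are sleeping except those at the root, which are active. If the particles of site $x$ are activated at time $T(x)$, the $i$-th of them ($1\le i\le\eta(x)$) is active and located at $S^x_n(i)$ at time $T(x)+n$ for $0\le n<\Xi^x_p(i)$, and then disappears. When an active particle visits a site, all sleeping particles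 there become active. Formally, $t(x,y)=\min_{1\le i\le\eta(x)}\min\{n<\Xi^x_p(i):S^x_n(i)=y\}$ for $x\ne y$ ($\infty$ if there is no such $n$), and $T(x)=\inf\{t(x_0,x_1)+\dots+t(x_{m-1},x_m)\}$ over all finite sequences $\mathbf{0}=x_0,x_1,\dots,x_m=x$, with $T(\mathbf{0})=0$; $T(x)=\infty$ means that $x$ is never visited by active particles. The root is hit infinitely often if there are infinitely many times at which some active particle is located at $\mathbf{0}$. Define $p_u(\mathcal{G},\eta)=\inf\{p\in[0,1]:\mathbf{P}[\mathbf{0}\text{ is hit infinitely often in }\mathrm{FM}(\mathcal{G},p,\eta)]>0\}$, with the convention $\inf\emptyset=1$. *)

(* Defs.v *)
From HB Require Import structures.
From mathcomp Require Import all_boot all_order all_algebra.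
From mathcomp Require Import finmap.
From mathcomp Require Import all_classical all_reals all_analysis.
Set Implicit Arguments.
Unset Strict Implicit.
Unset Printing Implicit Defensive.
Import Order.TTheory GRing.Theory Num.Theory.
Import numFieldNormedType.Exports.
Local Open Scope classical_set_scope.
Local Open Scope ring_scope.

Section Independence.
Context d (Om : measurableType d) (R : realType) (P : probability Om R).

Definition discrete_rv (T : countType) (X : Om -> T) : Prop :=
  forall y, measurable (X @^-1` [set y]).

(* As T is countable, the fibres generate the same sigma-algebra as the preimages
   of all subsets of T. *)
Definition sigma_of (K : Type) (T : countType) (X : K -> Om -> T) :
    set (set Om) :=
  <<s [set E | exists k y, E = X k @^-1` [set y]] >>.

Definition mutually_independent (I : choiceType) (F : I -> set (set Om)) :
    Prop :=
  forall (J : {fset I}) (A : I -> set Om),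
    (forall j, j \in J -> F j (A j)) ->
    P (\bigcap_(j in [set` J]) A j) = (\prod_(j <- J) P (A j))%E.

End Independence.

Section Graph.
Context (R : realType) (V : countType) (adj : rel V).

(* fset_set is meaningful on finite sets only: adj is meant to be locally
   finite. *)
Definition degree (x : V) : nat := #|` fset_set [set y | adj x y]|.

Definition step_prob (x y : V) : R :=
  if adj x y then (degree x)%:R^-1 else 0.

Definition is_simple_random_walk d (Om : measurableType d)
    (P : probability Om R) (x : V) (X : nat -> Om -> V) : Prop :=
  (forall n, discrete_rv (X n)) /\
  forall (n : nat) (y : nat -> V),
    P [set w | forall k, (k <= n)%N -> X k w = y k] =
    ((y 0%N == x)%:R * \prod_(k < n) step_prob (y k) (y k.+1))%:E.

End Graph.

(* Lifetimes take values in {0, 1, 2, ...} U {oo}, with None for oo. *)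
Definition alive (n : nat) (xi : option nat) : bool :=
  if xi is Some m then (n < m)%N else true.

Definition is_lifetime (R : realType) d (Om : measurableType d)
    (P : probability Om R) (p : R) (Xi : Om -> option nat) : Prop :=
  [/\ discrete_rv Xi,
      forall k, P (Xi @^-1` [set Some k.+1]) = ((1 - p) * p ^+ k)%:E &
      p = 1 -> P (Xi @^-1` [set None]) = 1%E].

(* The particles of a site are numbered from 0: walk x i and lifetime x i belong
   to the (i+1)-st particle of x, and count x particles start at x. *)
Record frogs (V Om : Type) := Frogs {
  count : V -> Om -> nat;
  walk : V -> nat -> nat -> Om -> V;
  lifetime : V -> nat -> Om -> option nat }.

Section FrogModel.
Context (R : realType) (V : countType) (adj : rel V) (root : V).

Section Law.
Context d (Om : measurableType d) (P : probability Om R).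
Context d0 (Om0 : measurableType d0) (P0 : probability Om0 R).

Definition frog_sigma (M : frogs V Om) (j : V + (V * nat) + (V * nat)) :
    set (set Om) :=
  match j with
  | inl (inl x) => sigma_of (fun _ : unit => count M x)
  | inl (inr (x, i)) => sigma_of (walk M x i)
  | inr (x, i) => sigma_of (fun _ : unit => lifetime M x i)
  end.

(* M realises, on (Om, P), the randomness of FM(G, p, eta), where eta is a random
   variable on (Om0, P0). *)
Record is_frog_model (p : R) (eta : {RV P0 >-> nat}) (M : frogs V Om) : Prop :=
  IsFrogModel {
    count_rv : forall x, discrete_rv (count M x);
    count_law : forall x k,
      P (count M x @^-1` [set k]) = P0 (eta @^-1` [set k]);
    walk_law : forall x i, is_simple_random_walk adj P x (walk M x i);
    lifetime_law : forall x i, is_lifetime P p (lifetime M x i);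
    frogs_independent : mutually_independent P (frog_sigma M) }.

End Law.

Section Dynamics.
Context (Om : Type) (M : frogs V Om).

Definition passage_time (x y : V) (w : Om) : \bar R :=
  ereal_inf [set (n%:R)%:E | n in [set n : nat | exists i : nat,
    [/\ (i < count M x w)%N, alive n (lifetime M x i w) &
        walk M x i n w = y]]].

(* Infimum over the sequences root = x_0, ..., x_m = x (m >= 0, consecutive terms
   distinct), s being x_1, ..., x_m. *)
Definition activation_time (x : V) (w : Om) : \bar R :=
  ereal_inf [set (\sum_(e <- zip (root :: s) s) passage_time e.1 e.2 w)%E
    | s in [set s : seq V | path (fun u v => u != v) root s
                            && (last root s == x)]].

Definition active_at (y : V) (m : nat) (w : Om) : Prop :=
  exists (x : V) (i n : nat),
    [/\ (i < count M x w)%N, alive n (lifetime M x i w),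
        walk M x i n w = y &
        (activation_time x w + (n%:R)%:E)%E = (m%:R)%:E].

Definition root_hit_io : set Om :=
  [set w | infinite_set [set m | active_at root m w]].

End Dynamics.

Section Critical.
Context d0 (Om0 : measurableType d0) (P0 : probability Om0 R).

(* The probability of root_hit_io only depends on p and on the law of eta, not on
   the realisation of the model. *)
Definition recurrent_params (eta : {RV P0 >-> nat}) : set R :=
  [set p | 0 <= p <= 1 /\
    exists (d : measure_display) (Om : measurableType d)
           (P : probability Om R) (M : frogs V Om),
      is_frog_model P p eta M /\ (0 < P (root_hit_io M))%E].

(* inf set0 = 0 in the library, whence the case distinction. *)
Definition p_u (eta : {RV P0 >-> nat}) : R :=
  if `[< recurrent_params eta = set0 >] then 1 else inf (recurrent_params eta).

End Critical.
End FrogModel.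

Definition Zd_adj (d : nat) : rel 'rV[int]_d :=
  fun x y => \sum_(i < d) `|x 0 i - y 0 i| == 1.

(* Main.v *)
(* Only the first Borel-Cantelli lemma is needed; neither the independence of the
   particles nor the activation dynamics matters. A particle starting at [x] needs
   at least [|x|_1] steps to reach the root, and it survives that long with
   probability at most [p ^ |x|_1]. Fix [b > 1] with [b p < 1]. The moment
   hypothesis says exactly that [P(eta > b ^ |x|_1)] is summable over the lattice,
   and [b ^ |x|_1 * p ^ |x|_1] is summable as well, so almost surely only finitely
   many sites hold a particle that can reach the root. As lifetimes are finite, the
   root is then hit finitely often. *)
Require Import Defs.
From HB Require Import structures.
From mathcomp Require Import all_boot all_order all_algebra.
From mathcomp Require Import all_classical all_reals all_analysis.
From mathcomp Require Import measurable_realfun zify ring lra.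
Import Order.TTheory GRing.Theory Num.Theory.
Import numFieldNormedType.Exports.
Local Open Scope classical_set_scope.
Local Open Scope ring_scope.

(** * Measurability, null sets and Borel-Cantelli over countable index types *)

Section CountablyManyEvents.
Context {d : measure_display} {Om : measurableType d}.

Lemma measurable_exists_countType (T : countType) (A : T -> Om -> Prop) :
  (forall t, measurable [set w | A t w]) ->
  measurable [set w | exists t, A t w].
Proof.
move=> mA; rewrite [X in measurable X](_ : _ = \bigcup_t [set w | A t w]).
  exact: countable_bigcupT_measurable.
by apply/seteqP; split=> w /= [t]; exists t.
Qed.

Lemma measurable_forall_countType (T : countType) (A : T -> Om -> Prop) :
  (forall t, measurable [set w | A t w]) ->
  measurable [set w | forall t, A t w].
Proof.
move=> mA.
rewrite [X in measurable X](_ : _ = ~` [set w | exists t, ~ A t w]).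
  apply: measurableC; apply: measurable_exists_countType => t.
  exact: measurableC (mA t).
apply/seteqP; split=> w /= => [Aw [t]|Aw t]; first by apply.
by apply: contrapT => nA; apply: Aw; exists t.
Qed.

Lemma measurable_Prop (Q : Prop) : measurable [set w : Om | Q].
Proof.
have [q|nq] := pselect Q.
  by rewrite [X in measurable X](_ : _ = setT)//; apply/seteqP; split.
by rewrite [X in measurable X](_ : _ = set0)//; apply/seteqP; split.
Qed.

Lemma discrete_rv_preimage (T : countType) (X : Om -> T) (B : set T) :
  discrete_rv X -> measurable (X @^-1` B).
Proof.
move=> mX.
rewrite [X in measurable X](_ : _ = [set w | exists y, B y /\ X w = y]).
  apply: measurable_exists_countType => y.
  exact: measurableI (measurable_Prop _) (mX y).
by apply/seteqP; split=> w /= => [Bw|[y [By Xy]]]; [exists (X w)|rewrite Xy].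
Qed.

(** The infimum is at least [c] exactly when each [t] is either inadmissible or satisfies
    [c <= f t w]. This is a countable intersection, although the set of admissible indices depends
    on [w]. *)
Lemma measurable_ereal_inf_countType {R : realType} (T : countType)
    (D : T -> Om -> Prop) (f : T -> Om -> \bar R) :
  (forall t, measurable [set w | D t w]) ->
  (forall t, measurable_fun setT (f t)) ->
  measurable_fun setT (fun w => ereal_inf [set f t w | t in [set t | D t w]]).
Proof.
move=> mD mf mT.
apply: (measurability _ (ErealGenCInfty.measurableE R)) => //.
move=> _ [_ [c ->] <-]; rewrite setTI.
rewrite [X in measurable X](_ : _ =
    [set w | forall t, ~ D t w \/ (c%:E <= f t w)%E]).
  apply: measurable_forall_countType => t.
  apply: (measurableU _ _ (measurableC (mD t))).
  by rewrite -[X in measurable X]setTI; exact: emeasurable_fun_c_infty.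
apply/seteqP; split=> w /=; rewrite in_itv/= andbT.
  move=> cw t; have [Dt|] := pselect (D t w); last by left.
  by right; apply: le_trans cw _; apply: ereal_inf_lbound; exists t.
by move=> cw; apply: le_ereal_inf_tmp => _ [t Dt <-]; case: (cw t).
Qed.

Context {R : realType}.

Lemma negligible_exists_countType (mu : {measure set Om -> \bar R})
    (T : countType) (A : T -> Om -> Prop) :
  (forall t, mu.-negligible [set w | A t w]) ->
  mu.-negligible [set w | exists t, A t w].
Proof.
move=> nA; pose F n := if @pickle_inv T n is Some t then [set w | A t w] else set0.
apply: (@negligibleS _ _ _ _ (\bigcup_n F n)).
  by move=> w [t Aw]; exists (pickle t) => //; rewrite /F pickleK_inv.
apply: negligible_bigcup => n; rewrite /F.
by case: pickle_inv => // *; exact: negligible_set0.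
Qed.

(** A common bound on the sums over duplicate-free lists expresses summability without choosing an
    enumeration of [T]. The codes given by [pickle] reduce the claim to a sequence of events. *)
Lemma borel_cantelli_countType (mu : {measure set Om -> \bar R})
    (T : countType) (E : T -> set Om) (c : R) :
  (forall t, measurable (E t)) ->
  (forall s : seq T, uniq s -> (\sum_(t <- s) mu (E t) <= c%:E)%E) ->
  mu.-negligible [set w | infinite_set [set t | E t w]].
Proof.
move=> mE sE; pose F n := if @pickle_inv T n is Some t then E t else set0.
have mF n : measurable (F n) by rewrite /F; case: pickle_inv.
exists (lim_sup_set F); split.
- by apply: bigcapT_measurable => n; exact: bigcup_measurable.
- apply: lim_sup_set_cvg0 => //.
  apply: (@le_lt_trans _ _ c%:E); last exact: ltry.
  apply: lime_le; first by apply: is_cvg_nneseries => *; exact: measure_ge0.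
  apply: nearW => n.
  (* A partial sum over codes is a sum over the decoded elements: numbers that are not codes
     contribute [set0], and distinct codes decode to distinct elements. *)
  rewrite [leLHS](_ : _ = \sum_(t <- pmap (@pickle_inv T) (index_iota 0 n)) mu (E t))%E.
    apply: sE; apply: (@pmap_uniq _ _ _ pickle); last exact: iota_uniq.
    exact: pickle_invK.
  elim: (index_iota 0 n) => [|k s IHs]; first by rewrite !big_nil.
  rewrite big_cons IHs /F /=; case: pickle_inv => [t|] /=.
    by rewrite big_cons.
  by rewrite measure0 add0e.
(* If no [F k] with [k >= n] contains [w], every [t] with [E t w] has a code below [n], which leaves
   finitely many. *)
- move=> w /= Ew n _; apply: contrapT => nF; apply: Ew.
  apply: (@sub_finite_set _ _ (\bigcup_(k in `I_n)
      [set t | @pickle_inv T k = Some t])).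
    move=> t /= Et; exists (pickle t) => /=; last by rewrite pickleK_inv.
    rewrite ltnNge; apply/negP => nt; apply: nF; exists (pickle t) => //.
    by rewrite /F pickleK_inv.
  apply: bigcup_finite => // k _; case: pickle_inv => [t|].
    by apply: (sub_finite_set _ (finite_set1 t)) => u /= [->].
  by apply: (sub_finite_set _ (finite_set0 _)) => u.
Qed.

End CountablyManyEvents.

(** * Counting and geometric sums on the lattice *)

Section LatticeSums.

Definition norm1 {d : nat} (x : 'rV[int]_d) : nat := \sum_(i < d) `|x 0%R i|%N.

(** The box [[-M, M]^d] is parametrised by a finite function space, which gives its cardinality and
    lets sums of products over it be factored. *)
Definition box_point {d M : nat} (f : {ffun 'I_d -> 'I_M.*2.+1}) : 'rV[int]_d :=
  \row_i ((f i)%:Z - M%:Z).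

Lemma box_point_inj d M : injective (@box_point d M).
Proof.
move=> f g /rowP fg; apply/ffunP => i; apply/val_inj => /=.
by have := fg i; rewrite !mxE => /addIr [].
Qed.

Lemma box_pointP d M (x : 'rV[int]_d) :
  (norm1 x <= M)%N -> x \in codom (@box_point d M).
Proof.
move=> xM.
have xiM i : (`|x 0%R i| <= M)%N.
  by apply: leq_trans xM; rewrite /norm1 (bigD1 i)//= leq_addr.
apply/codomP; exists [ffun i => inord `|(x 0 i + M%:Z)%R|%N].
apply/rowP => i; rewrite mxE ffunE inordK; last by move: (xiM i); lia.
by move: (xiM i); move: (x 0 i) => z zM; rewrite gez0_abs; lia.
Qed.

Lemma norm1_lt_count d (s : seq 'rV[int]_d) (M : nat) :
  uniq s -> {in s, forall x, (norm1 x <= M)%N} -> (size s <= M.*2.+1 ^ d)%N.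
Proof.
move=> us sM.
have -> : (M.*2.+1 ^ d = size (codom (@box_point d M)))%N.
  by rewrite size_codom card_ffun !card_ord.
by apply: uniq_leq_size => // x xs; exact/box_pointP/sM.
Qed.

Lemma geometric_symmetric_sum_le {R : realFieldType} (r : R) (M : nat) :
  0 <= r < 1 -> \sum_(k < M.*2.+1) r ^+ `|k%:Z - M%:Z|%N <= 2 / (1 - r).
Proof.
move=> /andP[r0 r1].
(* The closed form of [1 + 2 (r + ... + r^M)] can be carried through an induction; the bound then
   follows from [1 + r <= 2]. *)
suff -> : \sum_(k < M.*2.+1) r ^+ `|k%:Z - M%:Z|%N =
    (1 + r - 2 * r ^+ M.+1) / (1 - r).
  rewrite ler_pM2r ?invr_gt0 ?subr_gt0//.
  have := exprn_ge0 M.+1 r0; lra.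
have r1' : 1 - r != 0 by rewrite gt_eqF// subr_gt0.
elim: M => [|M IHM].
  by rewrite big_ord_recl big_ord0 expr0 expr1; field.
(* The two end terms both equal [r^(M+1)], and the inner ones, shifted by one, form the sum for
   [M]. *)
rewrite doubleS big_ord_recl big_ord_recr /=.
rewrite (eq_bigr (fun k : 'I_M.*2.+1 => r ^+ `|k%:Z - M%:Z|%N)); last first.
  by move=> k _; congr (_ ^+ _); rewrite /bump /=; lia.
rewrite IHM subn0.
have -> : `|(bump 0 M.*2.+1)%:Z - M.+1%:Z|%N = M.+1 by rewrite /bump /=; lia.
by rewrite (exprS r M.+1); field.
Qed.

(** Enlarging [s] to a box only adds nonnegative terms. On the box, [r ^+ norm1 x] is a product over
    coordinates, so the sum is the [d]-th power of a one-dimensional sum. *)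
Lemma norm1_geometric_sum_le {R : realFieldType} d (r : R) (s : seq 'rV[int]_d) :
  0 <= r < 1 -> uniq s -> \sum_(x <- s) r ^+ norm1 x <= (2 / (1 - r)) ^+ d.
Proof.
move=> r01 us; pose M := \max_(x <- s) norm1 x.
have r0 : 0 <= r by case/andP: r01.
pose B := codom (@box_point d M).
have uB : uniq B by apply/injectiveP; exact: box_point_inj.
have sB : {subset s <= B}.
  by move=> x xs; apply: box_pointP; rewrite /M (big_rem x)//= leq_maxl.
have sE : perm_eq s [seq x <- B | x \in s].
  apply: uniq_perm => //; first exact: filter_uniq.
  by move=> x; rewrite mem_filter; case: (boolP (x \in s)) => // /sB ->.
apply: (@le_trans _ _ (\sum_(x <- B) r ^+ norm1 x)).
  rewrite (perm_big _ sE)/= big_filter [leRHS](bigID (mem s))/= lerDl.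
  by apply: sumr_ge0 => x _; exact: exprn_ge0.
rewrite /B big_image /=.
under eq_bigr => f _.
  rewrite /norm1 expr_sum.
  under eq_bigr do rewrite mxE.
  over.
rewrite -(bigA_distr_bigA (fun (i : 'I_d) (k : 'I_M.*2.+1) =>
  r ^+ `|k%:Z - M%:Z|%N)) /= prodr_const card_ord.
apply: lerXn2r; rewrite ?nnegrE.
- by apply: sumr_ge0 => k _; exact: exprn_ge0.
- by rewrite divr_ge0// subr_ge0 ltW//; case/andP: r01.
- exact: geometric_symmetric_sum_le.
Qed.

End LatticeSums.

(** * The hitting event, lifetimes and walk trajectories *)

Section Frogs.
Context {R : realType} {d : measure_display} {Om : measurableType d}.

(** Measurability later turns negligibility of this event into probability [0]. Every quantifier and
    infimum in the dynamics ranges over a countable type; for activation times this is the type of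
    finite sequences of sites. *)
Lemma measurable_root_hit_io (V : countType) (root : V) (M : frogs V Om) :
  (forall x, discrete_rv (Defs.count M x)) ->
  (forall x i n, discrete_rv (walk M x i n)) ->
  (forall x i, discrete_rv (lifetime M x i)) ->
  measurable (root_hit_io R root M).
Proof.
move=> mcount mwalk mlife.
have mcond x y i n : measurable [set w | [/\ (i < Defs.count M x w)%N,
    alive n (lifetime M x i w) & walk M x i n w = y]].
  rewrite [X in measurable X](_ : _ =
    Defs.count M x @^-1` [set k | (i < k)%N] `&`
    (lifetime M x i @^-1` [set l | alive n l] `&` walk M x i n @^-1` [set y])).
    by do 2 ?apply: measurableI; try exact: discrete_rv_preimage; exact: mwalk.
  by apply/seteqP; split => w /= => [[? ? ?]|[? [? ?]]]; split.
have mpassage x y : measurable_fun setT (passage_time R M x y).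
  apply: (@measurable_ereal_inf_countType _ _ _ _
    (fun n w => exists i, [/\ (i < Defs.count M x w)%N,
    alive n (lifetime M x i w) & walk M x i n w = y])
    (fun n _ => (n%:R)%:E)) => n //.
  exact: measurable_exists_countType.
have mactivation x : measurable_fun setT (activation_time R root M x).
  apply: (@measurable_ereal_inf_countType _ _ _ _
    (fun s _ => path (fun u v => u != v) root s && (last root s == x))
    (fun s w => \sum_(e <- zip (root :: s) s) passage_time R M e.1 e.2 w)%E) => s.
    exact: measurable_Prop.
  by apply: emeasurable_sum => e.
have mactive m : measurable [set w | active_at R root M root m w].
  apply: measurable_exists_countType => x.
  apply: measurable_exists_countType => i.
  apply: measurable_exists_countType => n.
  rewrite [X in measurable X](_ : _ = [set w | [/\ (i < Defs.count M x w)%N,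
    alive n (lifetime M x i w) & walk M x i n w = root]] `&`
    (fun w => (activation_time R root M x w + n%:R%:E)%E) @^-1` [set m%:R%:E]).
    apply: measurableI => //; rewrite -[X in measurable X]setTI.
    by apply: emeasurable_funD => //.
  by apply/seteqP; split => w /=; [case|case=> -[]].
(* A set of natural numbers is infinite exactly when it is unbounded. *)
rewrite [X in measurable X](_ : _ = [set w | forall k, exists m,
    (k <= m)%N /\ active_at R root M root m w]).
  apply: measurable_forall_countType => k.
  apply: measurable_exists_countType => m.
  exact: measurableI (measurable_Prop _) (mactive m).
apply/seteqP; split => w /=.
  move=> infw k; apply: contrapT => nk; apply: infw.
  apply: (sub_finite_set _ (finite_II k)) => m /= am.
  by rewrite ltnNge; apply/negP => km; apply: nk; exists m.
move=> unb /finite_seqP[s sE].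
have [m [sm am]] := unb (\max_(k <- s) k).+1.
have ms : m \in s.
  have : [set m | active_at R root M root m w] m by [].
  by rewrite sE.
by move: sm; rewrite (big_rem m)//= ltnNge leq_maxl.
Qed.

(** This transfers tails of [eta], which lives on its own probability space, to the particle
    counts. *)
Lemma eq_discrete_law {d' : measure_display} {Om' : measurableType d'}
    (P : probability Om R) (P' : probability Om' R) (X : Om -> nat)
    (Y : Om' -> nat) (B : set nat) :
  discrete_rv X -> discrete_rv Y ->
  (forall k, P (X @^-1` [set k]) = P' (Y @^-1` [set k])) ->
  P (X @^-1` B) = P' (Y @^-1` B).
Proof.
have fibres T (Z : T -> nat) : Z @^-1` B = \bigcup_(k in B) Z @^-1` [set k].
  by apply/seteqP; split=> w /= => [Bw|[k Bk ->]]; [exists (Z w)|].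
have tI T (Z : T -> nat) : trivIset B (fun k => Z @^-1` [set k]).
  by move=> i j _ _ [w [/= <- <-]].
move=> mX mY XY; rewrite (fibres _ X) (fibres _ Y) !measure_bigcup//.
by apply: eq_eseriesr => k _; exact: XY.
Qed.

(** A particle alive at age [n] has a lifetime outside [{1, ..., n}], and the mass of that set
    telescopes to [1 - p^n]. *)
Lemma lifetime_tail_le (P : probability Om R) (p : R) (Xi : Om -> option nat)
    (n : nat) : is_lifetime P p Xi ->
  (P [set w | alive n (Xi w)] <= (p ^+ n)%:E)%E.
Proof.
move=> [mXi lawXi _].
pose short := \bigcup_(k in `I_n) Xi @^-1` [set Some k.+1].
have mfib y : measurable (Xi @^-1` [set y]) by exact: mXi.
have Pshort : P short = (1 - p ^+ n)%:E.
  rewrite /short measure_fin_bigcup//; last first.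
    by move=> i j _ _ [w [/= -> [->]]].
  rewrite -fsbig_ord/= (eq_bigr (fun k : 'I_n => ((1 - p) * p ^+ k)%:E)).
    by rewrite sumEFin -mulr_sumr -opprB mulNr -subrX1 opprB.
  by move=> k _; exact: lawXi.
have mshort : measurable short by exact: fin_bigcup_measurable.
apply: (@le_trans _ _ (P (~` short))).
  apply: le_measure; rewrite ?inE//.
  - exact: (discrete_rv_preimage _ _ [set l | alive n l] mXi).
  - exact: measurableC.
  - by move=> w /= aw [k kn /= XiE]; move: aw; rewrite XiE/= ltnS leqNgt kn.
by rewrite probability_setC// Pshort -EFinB opprB addrC subrK.
Qed.

(** An infinite lifetime survives every age [n], so its probability is at most [p^n] for all [n]. *)
Lemma lifetime_finite (P : probability Om R) (p : R) (Xi : Om -> option nat) :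
  0 <= p < 1 -> is_lifetime P p Xi -> P.-negligible (Xi @^-1` [set None]).
Proof.
move=> /andP[p0 p1] lXi; have [mXi _ _] := lXi.
exists (Xi @^-1` [set None]); split=> //.
apply/eqP; rewrite -measure_le0.
have cvp : (p ^+ n)%:E @[n --> \oo] --> 0%E.
  by apply: cvg_EFin; [exact: nearW|apply: cvg_expr; rewrite ger0_norm].
rewrite -(cvg_lim _ cvp)//; apply: lime_ge; first by apply/cvg_ex; exists 0%E.
apply: nearW => n; apply: le_trans (lifetime_tail_le _ _ _ n lXi).
apply: le_measure; rewrite ?inE//.
- exact: (discrete_rv_preimage _ _ [set l | alive n l] mXi).
- by move=> w /= ->.
Qed.

(** A violation is already visible on a finite initial piece of the trajectory. There are countably
    many such pieces, and each has probability [0] because its law contains a vanishing factor. *)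
Lemma walk_follows_edges (V : countType) (adj : rel V) (P : probability Om R)
    (x : V) (X : nat -> Om -> V) : is_simple_random_walk adj P x X ->
  P.-negligible [set w | ~ (X 0%N w = x /\ forall k, adj (X k w) (X k.+1 w))].
Proof.
move=> [mX lawX].
(* The walk follows the list [ns.2] up to time [ns.1], and that list has a wrong start or a step off
   the edges. *)
pose A (ns : nat * seq V) (w : Om) := (forall k, (k <= ns.1)%N ->
    X k w = nth x ns.2 k) /\ ~ (nth x ns.2 0%N = x /\
    forall k, (k < ns.1)%N -> adj (nth x ns.2 k) (nth x ns.2 k.+1)).
apply: (@negligibleS _ _ _ _ [set w | exists ns, A ns w]).
  move=> w /= bad; apply: contrapT => nA; apply: bad.
  have XE n : X 0%N w = x /\ forall k, (k < n)%N -> adj (X k w) (X k.+1 w).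
    apply: contrapT => badn; apply: nA; exists (n, mkseq (X ^~ w) n.+1).
    split=> [k /= kn|[X0 Xk]]; first by rewrite nth_mkseq.
    apply: badn; split=> [//|k kn].
    have := Xk k kn; rewrite !nth_mkseq ?ltnS //=; exact: ltnW.
  by split=> [|k]; [case: (XE 0%N)|case: (XE k.+1) => _; apply].
apply: negligible_exists_countType => -[n s].
have [good|bad] := pselect (nth x s 0%N = x /\
    forall k, (k < n)%N -> adj (nth x s k) (nth x s k.+1)).
  by apply: (negligibleS _ (negligible_set0 P)) => w [].
exists [set w | forall k, (k <= n)%N -> X k w = nth x s k]; split.
- apply: measurable_forall_countType => k.
  rewrite [X in measurable X](_ : _ =
    [set w | ~ (k <= n)%N] `|` X k @^-1` [set nth x s k]).
    by apply: measurableU; [exact: measurable_Prop|exact: mX].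
  apply/seteqP; split=> w /=; last by case=> [nkn /nkn|].
  by move=> Xk; have [/Xk|] := pselect (k <= n)%N; [right|left].
(* A wrong start kills the indicator factor; otherwise some step is not an edge and its [step_prob]
   is [0]. *)
- apply: (etrans (lawX n (nth x s))); case: eqVneq => [x0|_]; last by rewrite mul0r.
  have [k /andP[kn nadj]] : exists k, (k < n)%N && ~~ adj (nth x s k) (nth x s k.+1).
    apply: contrapT => nk; apply: bad; split=> // k kn.
    by apply: contrapT => /negP nadj; apply: nk; exists k; rewrite kn.
  rewrite (bigD1 (Ordinal kn))//= /step_prob (negbTE nadj).
  by rewrite mul0r mulr0.
- by move=> w [].
Qed.

Lemma norm1D n (x y : 'rV[int]_n) : (norm1 (x + y) <= norm1 x + norm1 y)%N.
Proof.
rewrite /norm1 -big_split; apply: leq_sum => i _ /=.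
by rewrite mxE; move: (x 0%R i) (y 0%R i) => a b; lia.
Qed.

Lemma Zd_adj_norm1 n (x y : 'rV[int]_n) : Zd_adj x y -> norm1 (x - y) = 1%N.
Proof.
rewrite /Zd_adj /norm1 => /eqP xy.
apply/eqP; rewrite -eqz_nat; apply/eqP; apply: (etrans _ xy).
rewrite -[LHS]natz natr_sum; apply: eq_bigr => i _.
by rewrite !mxE natz abszE.
Qed.

(** Each step lowers the norm by at most [1], so [norm1 (X j) + j] never drops below its initial
    value. *)
Lemma walk_hit_time n (X : nat -> 'rV[int]_n) k :
  (forall j, Zd_adj (X j) (X j.+1)) -> X k = 0 -> (norm1 (X 0%N) <= k)%N.
Proof.
move=> adjX Xk.
suff step j : (norm1 (X 0%N) <= j + norm1 (X j))%N.
  apply: leq_trans (step k) _; rewrite Xk /norm1 big1 ?addn0// => i _.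
  by rewrite mxE.
elim: j => [//|j IHj]; apply: leq_trans IHj _.
rewrite addSnnS leq_add2l -add1n -(Zd_adj_norm1 _ _ _ (adjX j)).
by rewrite -{1}(subrK (X j.+1) (X j)) norm1D.
Qed.

End Frogs.

(** * Tail sums from the logarithmic moment *)

(** For a fixed outcome, the sites with [b ^ norm1 x < eta] lie in a ball of radius [log_b eta], so
    their number is at most of order [1 + (log_b eta)^n]. Integrating this count bounds the sum of
    probabilities, uniformly in [s]. *)
Lemma log_moment_tail_sum {R : realType} {d0 : measure_display}
    {Om0 : measurableType d0} (P0 : probability Om0 R) (eta : {RV P0 >-> nat})
    (n : nat) (b : R) : 1 < b ->
  ('E_P0[fun w => (ln (maxn (eta w) 1)%:R ^+ n)%R] < +oo)%E ->
  exists c : R, forall s : seq 'rV[int]_n, uniq s ->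
    (\sum_(x <- s) P0 (eta @^-1` [set k | (b ^+ norm1 x < k%:R)%R]) <= c%:E)%E.
Proof.
move=> b1 Efin.
pose g w : R := ln (maxn (eta w) 1)%:R ^+ n.
have b0 : 0 < b by exact: lt_trans b1.
have lnb : 0 < ln b by exact: ln_gt0.
have lneta w : 0 <= ln (maxn (eta w) 1)%:R :> R.
  by apply: ln_ge0; rewrite ler1n leq_maxr.
have g0 w : 0 <= g w by exact: exprn_ge0.
have mg : measurable_fun setT g.
  by apply: (measurableT_comp (f := fun k : nat => ln (maxn k 1)%:R ^+ n : R)).
pose A (x : 'rV[int]_n) := eta @^-1` [set k | b ^+ norm1 x < k%:R].
have mA x : measurable (A x) by exact: measurable_funPTI.
pose K : R := (ln b ^+ n)^-1.
have K0 : 0 <= K by rewrite invr_ge0 exprn_ge0// ltW.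
have count_le (s : seq 'rV[int]_n) w : uniq s ->
    \sum_(x <- s) \1_(A x) w <= 3 ^+ n + 3 ^+ n * K * g w.
  move=> us; pose L := ln (maxn (eta w) 1)%:R / ln b.
  have L0 : 0 <= L by rewrite divr_ge0// ltW.
  have /andP[ML LM] := truncn_itv L0; set M := Num.truncn L in ML LM.
  have -> : \sum_(x <- s) \1_(A x) w = (size [seq x <- s | w \in A x])%:R :> R.
    rewrite size_filter -sum1_count natr_sum [RHS]big_mkcond/=.
    by apply: eq_bigr => x _; rewrite indicE; case: (w \in A x).
  (* Taking logarithms in [b ^ norm1 x < eta w] gives [norm1 x <= L < M + 1]. *)
  have sM : {in [seq x <- s | w \in A x], forall x, (norm1 x <= M)%N}.
    move=> x; rewrite mem_filter => /andP[/set_mem bx _]; rewrite /A/= in bx.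
    rewrite -ltnS -(ltr_nat R); apply: le_lt_trans LM.
    rewrite ler_pdivlMr// mulr_natl -lnXn//.
    have eta0 : 0 < (maxn (eta w) 1)%:R :> R by rewrite ltr0n leq_max orbT.
    rewrite ler_ln ?posrE ?exprn_gt0//.
    by apply: (le_trans (ltW bx)); rewrite ler_nat leq_maxl.
  have := norm1_lt_count _ _ _ (filter_uniq _ us) sM.
  rewrite -(ler_nat R) natrX => /le_trans; apply.
  (* Since [M <= L], the side [2 M + 1] of the box is at most [3 max(1, L)]; then
     [max(1, L)^n <= 1 + L^n]. *)
  apply: (@le_trans _ _ ((3 * Num.max 1 L) ^+ n)).
    apply: lerXn2r; rewrite ?nnegrE ?mulr_ge0 ?le_max ?ler01//.
    rewrite -addn1 -muln2 natrD natrM.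
    have : 1 <= Num.max 1 L by rewrite le_max lexx.
    have : L <= Num.max 1 L by rewrite le_max lexx orbT.
    by move: ML; lra.
  rewrite exprMn -mulrA -[X in _ <= X + _]mulr1 -mulrDr ler_wpM2l ?exprn_ge0//.
  have -> : K * g w = L ^+ n by rewrite /L expr_div_n mulrC.
  rewrite /Num.max; case: ifP => _; first by rewrite lerDr.
  by rewrite expr1n lerDl exprn_ge0.
have Eg : ('E_P0[g] = \int[P0]_w (g w)%:E)%E by rewrite unlock.
have Efnum : 'E_P0[g]%E \is a fin_num.
  by rewrite ge0_fin_numE//; exact: expectation_ge0.
exists (3 ^+ n + 3 ^+ n * K * fine 'E_P0[g]) => s us.
rewrite (eq_bigr (fun x => \int[P0]_w (\1_(A x) w)%:E)%E); last first.
  by move=> x _; rewrite integral_indic// setIT.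
rewrite -ge0_integral_sum//; last first.
  by move=> x; apply/measurable_EFinP; exact: measurable_indic.
apply: (@le_trans _ _ (\int[P0]_w ((3 ^+ n)%:E + (3 ^+ n * K)%:E * (g w)%:E))%E).
  apply: ge0_le_integral => //.
  - by move=> w _; apply: sume_ge0 => x _; rewrite lee_fin.
  - apply: emeasurable_sum => x; apply/measurable_EFinP.
    exact: measurable_indic.
  - apply: emeasurable_funD => //; apply: emeasurable_funM => //.
    exact/measurable_EFinP.
  - by move=> w _; rewrite sumEFin -EFinM -EFinD lee_fin count_le.
have c0 : 0 <= 3 ^+ n * K by rewrite mulr_ge0 ?exprn_ge0.
have mgE : measurable_fun setT (EFin \o g) by exact/measurable_EFinP.
rewrite ge0_integralD//=; last 2 first.
- by move=> w _; rewrite mule_ge0// lee_fin.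
- exact: emeasurable_funM.
rewrite ge0_integralZl//; last by move=> w _; rewrite lee_fin.
rewrite -Eg -[X in (_ * X)%E](fineK Efnum).
have -> : (\int[P0]__ (3 ^+ n)%:E = (3 ^+ n)%:E)%E.
  by have := expectation_cst P0 (3 ^+ n); rewrite unlock.
by [].
Qed.

(** * From finitely many relevant sites to the critical value *)

(** Survival up to age [norm1 x] stands in for reaching the root: it is a necessary condition that
    depends on counts and lifetimes alone. *)
Lemma finitely_many_sites_reach_root {R : realType} (n : nat)
    {d d0 : measure_display} {Om : measurableType d} {Om0 : measurableType d0}
    (P : probability Om R) (P0 : probability Om0 R) (eta : {RV P0 >-> nat})
    (p : R) (M : frogs 'rV[int]_n Om) : 0 <= p < 1 ->
  ('E_P0[fun w => (ln (maxn (eta w) 1)%:R ^+ n)%R] < +oo)%E ->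
  is_frog_model (@Zd_adj n) P p eta M ->
  P.-negligible [set w | infinite_set [set x | exists i,
    (i < Defs.count M x w)%N /\ alive (norm1 x) (lifetime M x i w)]].
Proof.
move=> /andP[p0 p1] Efin fM.
(* As [p < 1], this choice gives [b > 1], and [b p < 1] because [2 p < 1 + p]. *)
pose b := 2 / (1 + p).
have b1 : 1 < b by rewrite /b ltr_pdivlMr; lra.
have b0 : 0 < b by exact: lt_trans b1.
have bp : 0 <= b * p < 1.
  apply/andP; split; first exact: mulr_ge0 (ltW b0) p0.
  by rewrite /b mulrAC ltr_pdivrMr; lra.
have [c cP] := log_moment_tail_sum P0 eta n b b1 Efin.
have mlong x i : measurable [set w | alive (norm1 x) (lifetime M x i w)].
  have [mXi _ _] := lifetime_law fM x i.
  exact: (discrete_rv_preimage _ _ [set l | alive (norm1 x) l] mXi).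
have mmany x B : measurable (Defs.count M x @^-1` B).
  exact/discrete_rv_preimage/(count_rv fM).
pose E x := [set w | exists i,
  (i < Defs.count M x w)%N /\ alive (norm1 x) (lifetime M x i w)].
have mE x : measurable (E x).
  apply: measurable_exists_countType => i.
  exact: measurableI (mmany x [set k | (i < k)%N]) (mlong x i).
have PE x : (P (E x) <= P0 (eta @^-1` [set k | (b ^+ norm1 x < k%:R)%R]) +
    ((b * p) ^+ norm1 x)%:E)%E.
  (* If the count is at most [b ^ norm1 x], it is at most [N], so only the first [N] lifetimes
     matter. The union bound then costs [N p ^ norm1 x <= (b p) ^ norm1 x]. *)
  pose N := Num.truncn (b ^+ norm1 x).
  have bx0 : 0 <= b ^+ norm1 x by rewrite exprn_ge0// ltW.
  have /andP[NB BN] := truncn_itv bx0.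
  pose many := Defs.count M x @^-1` [set k | b ^+ norm1 x < k%:R].
  have Pmany : P many = P0 (eta @^-1` [set k | b ^+ norm1 x < k%:R]).
    apply: eq_discrete_law; first exact: (count_rv fM).
      by move=> k; exact: measurable_funPTI.
    by move=> k; exact: (count_law fM).
  pose long_i i := [set w | alive (norm1 x) (lifetime M x i w)].
  pose long := \big[setU/set0]_(i < N) long_i i.
  have mmy : measurable many by exact: mmany.
  have mlg : measurable long by apply: bigsetU_measurable => i _; exact: mlong.
  apply: (@le_trans _ _ (P (many `|` long))).
    apply: le_measure; rewrite ?inE//; first exact: measurableU mmy mlg.
    move=> w [i [ic ai]]; rewrite /many/=.
    have [cb|bc] := leP (Defs.count M x w)%:R (b ^+ norm1 x); last by left.
    right; rewrite /long -(bigcup_mkord N long_i); exists i => //=.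
    apply: leq_trans ic _; rewrite -ltnS -(ltr_nat R).
    exact: le_lt_trans cb BN.
  apply: (le_trans (measureU2 P _ _)) => //; apply: leeD.
    by have := lexx (P many); rewrite {2}Pmany.
  apply: (le_trans (Boole_inequality P (A := long_i) (n := N) _)).
    by move=> i _; exact: mlong.
  apply: (@le_trans _ _ (\sum_(i < N) (p ^+ norm1 x)%:E)%E).
    by apply: lee_sum => i _; exact/lifetime_tail_le/(lifetime_law fM).
  rewrite sumEFin lee_fin sumr_const card_ord -mulr_natl exprMn.
  by rewrite ler_wpM2r// exprn_ge0.
apply: (borel_cantelli_countType P _ E (c + (2 / (1 - b * p)) ^+ n)) => // s us.
apply: (le_trans (lee_sum _ (fun x _ => PE x))).
rewrite big_split/= EFinD; apply: leeD; first exact: cP.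
by rewrite sumEFin lee_fin norm1_geometric_sum_le.
Qed.

Lemma root_hit_io_null {R : realType} (n : nat)
    {d d0 : measure_display} {Om : measurableType d} {Om0 : measurableType d0}
    (P : probability Om R) (P0 : probability Om0 R) (eta : {RV P0 >-> nat})
    (p : R) (M : frogs 'rV[int]_n Om) : 0 <= p < 1 ->
  ('E_P0[fun w => (ln (maxn (eta w) 1)%:R ^+ n)%R] < +oo)%E ->
  is_frog_model (@Zd_adj n) P p eta M ->
  P (root_hit_io R 0 M) = 0%E.
Proof.
move=> p01 Efin fM.
have mhit : measurable (root_hit_io R 0 M).
  apply: measurable_root_hit_io => [x|x i k|x i].
  - exact: (count_rv fM).
  - by have [mX _] := walk_law fM x i; exact: mX.
  - by have [] := lifetime_law fM x i.
apply/negligibleP => //.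
have Nimm : P.-negligible [set w | exists xi : 'rV[int]_n * nat,
    lifetime M xi.1 xi.2 w = None].
  apply: negligible_exists_countType => -[x i].
  exact/lifetime_finite/(lifetime_law fM).
have Nwalk : P.-negligible [set w | exists xi : 'rV[int]_n * nat,
    ~ (walk M xi.1 xi.2 0%N w = xi.1 /\ forall k,
       Zd_adj (walk M xi.1 xi.2 k w) (walk M xi.1 xi.2 k.+1 w))].
  apply: negligible_exists_countType => -[x i].
  exact/walk_follows_edges/(walk_law fM).
apply: negligibleS (negligibleU
  (finitely_many_sites_reach_root _ _ _ _ _ _ p01 Efin fM)
  (negligibleU Nimm Nwalk)).
move=> w hit; apply: contrapT => /not_orP[/contrapT fin /not_orP[imm wlk]].
apply: hit.
(* The default [0] is never reached: [imm] excludes infinite lifetimes at [w]. *)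
pose life x i := odflt 0%N (lifetime M x i w).
pose hits x k := [set m : nat | (activation_time R 0%R M x w + k%:R%:E)%E = m%:R%:E].
(* Hitting times are indexed by a site, a particle and an age, each ranging over a finite set at
   [w]. *)
have sub : [set m | active_at R 0 M 0 m w] `<=` \bigcup_(x in [set x | exists i,
    (i < Defs.count M x w)%N /\ alive (norm1 x) (lifetime M x i w)])
  \bigcup_(i in `I_(Defs.count M x w)) \bigcup_(k in `I_(life x i)) hits x k.
  move=> m [x [i [k [ic ak wk tm]]]].
  have [w0 wadj] : walk M x i 0%N w = x /\
      forall j, Zd_adj (walk M x i j w) (walk M x i j.+1 w).
    by apply: contrapT => nw; apply: wlk; exists (x, i).
  have xk : (norm1 x <= k)%N.
    by have := walk_hit_time _ (fun j => walk M x i j w) k wadj wk; rewrite w0.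
  exists x.
    exists i; split=> //; move: ak.
    by case: lifetime => //= l; exact: leq_ltn_trans.
  exists i => //; exists k => //=; rewrite /life.
  case lE : (lifetime M x i w) ak => [l|] //= _.
  by exfalso; apply: imm; exists (x, i).
apply: (sub_finite_set sub); apply: bigcup_finite => // x _; apply: bigcup_finite => // i _.
apply: bigcup_finite => // k _.
(* Site and age determine the time, so [hits x k] has at most one element; it is empty when the
   activation time is infinite. *)
have [[m0 m0E]|none] := pselect (exists m, hits x k m).
  apply: (sub_finite_set _ (finite_set1 m0)) => m mE.
  by have [/eqP] := etrans (esym mE) m0E; rewrite eqr_nat => /eqP.
by apply: (sub_finite_set _ (finite_set0 _)) => m mE; apply: none; exists m.
Qed.

Theorem theorem1p10 (R : realType) (d : nat) (hd : (1 <= d)%N)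
    (d0 : measure_display) (Om0 : measurableType d0) (P0 : probability Om0 R)
    (eta : {RV P0 >-> nat})
    (eta_pos : (0 < P0 [set w | (1 <= eta w)%N])%E)
    (eta_log : ('E_P0[fun w => (ln (maxn (eta w) 1)%:R ^+ d)%R] < +oo)%E) :
  p_u (@Zd_adj d) 0 eta = 1.
Proof.
rewrite /p_u; case: asboolP => // /eqP/set0P[q qrec].
(* In the remaining case the set of recurrent parameters is nonempty; if [1] is its only possible
   element, it equals [{1}] and its infimum is [1]. *)
suff rec1 p : recurrent_params (@Zd_adj d) 0 eta p -> p = 1.
  rewrite (_ : recurrent_params _ _ _ = [set 1]) ?inf1//.
  by apply/seteqP; split=> [p /rec1 //|p /= ->]; rewrite -(rec1 q qrec).
move=> [/andP[p0 p1] [dO [Om [P [M [fM Phit]]]]]].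
apply/eqP; rewrite eq_le p1 leNgt; apply/negP => plt.
by move: Phit; rewrite (root_hit_io_null _ _ _ _ p _ _ eta_log fM) ?ltxx ?p0.
Qed.
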